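(* Let $X$ be a real Banach space. The following two conditions are equivalent: (a) there is a constant $\gamma>0$ such that for every real Banach space $Y$, every $\varepsilon\ge 0$ and every standard $\varepsilon$-isometry $f:X\to Y$ there exists a bounded linear operator $T:L(f)\to X$ satisfying $\|Tf(x)-x\|\le\gamma\varepsilon$ for all $x\in X$; (b) $X$ is a cardinality injective space.
   Context: All Banach spaces are real. For $\varepsilon\ge0$, a map $f:X\to Y$ between Banach spaces (not assumed linear, continuous or surjective) is called a standard $\varepsilon$-isometry if $f(0)=0$ and $\big|\|f(x)-f(y)\|-\|x-y\|\big|\le\varepsilon$ for all $x,y\in X$. For such $f$, $L(f)=\overline{\mathrm{span}}\,f(X)$ denotes the closed linear span of $f(X)$ in $Y$. A Banach space $X$ is called cardinality injective if there exists a constant $\lambda\ge0$ such that for every Banach space $Y$ isometrically containing $X$ (i.e. $X$ is identified with a closed linear subspace of $Y$ via a linear isometric embedding) and having the same cardinality as $X$, i.e. $\mathrm{card}(Y)=\mathrm{card}(X)$, there is a linear projection $P:Y\to X$ of $Y$ onto $X$ with $\|P\|\le\lambda$. *)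

(* Defs.v *)
From HB Require Import structures.
From mathcomp Require Import all_boot all_order all_algebra.
From mathcomp Require Import all_classical all_reals all_analysis.

Set Implicit Arguments.
Unset Strict Implicit.
Unset Printing Implicit Defensive.

Import Order.TTheory GRing.Theory Num.Theory.
Import numFieldNormedType.Exports.

Local Open Scope classical_set_scope.
Local Open Scope ring_scope.
Local Open Scope card_scope.

Definition standard_eps_isometry (R : realType) (X Y : normedModType R)
    (eps : R) (f : X -> Y) : Prop :=
  f 0 = 0 /\ forall x y : X, `| `|f x - f y| - `|x - y| | <= eps.

Definition linear_span (R : realType) (V : lmodType R) (S : set V) : set V :=
  [set v | exists (n : nat) (c : 'I_n -> R) (s : 'I_n -> V),
     (forall i, S (s i)) /\ v = \sum_(i < n) c i *: s i].

Definition closed_span (R : realType) (V : normedModType R) (S : set V) :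
    set V :=
  closure (linear_span S).

(* An operator with domain a linear subspace A is represented by a function
   defined on the whole space, whose values outside A are irrelevant: neither
   linearity nor boundedness is required there. *)
Definition bounded_linear_on (R : realType) (V W : normedModType R)
    (A : set V) (T : V -> W) : Prop :=
  (forall (a : R) (u v : V), A u -> A v -> T (a *: u + v) = a *: T u + T v) /\
  exists M : R, forall u : V, A u -> `|T u| <= M * `|u|.

(* Extended-real valued, so that an upper bound on it entails boundedness. *)
Definition operator_norm (R : realType) (V W : normedModType R)
    (T : V -> W) : \bar R :=
  ereal_sup [set (`|T v|)%:E | v in [set v : V | `|v| <= 1]].

(* The inclusion of X in Y is a linear isometric embedding j, and X is
   identified with range j (closed, since X is complete). *)
Definition cardinality_injective (R : realType) (X : completeNormedModType R) :
    Prop :=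
  exists2 lambda : R, 0 <= lambda &
    forall (Y : completeNormedModType R) (j : {linear X -> Y}),
      (forall x : X, `|j x| = `|x|) ->
      [set: Y] #= [set: X] ->
      exists P : {linear Y -> Y},
        [/\ forall y : Y, P (P y) = P y,
            range P = range j
          & (operator_norm P <= lambda%:E)%E].

(* Main.v *)
Require Import Defs.
From HB Require Import structures.
From mathcomp Require Import all_boot all_order all_algebra.
From mathcomp Require Import all_classical all_reals all_analysis.
From mathcomp Require Import ring lra.

Import Order.TTheory GRing.Theory Num.Theory.
Import numFieldNormedType.Exports.

Local Open Scope classical_set_scope.
Local Open Scope ring_scope.

(** From (a) to (b).  Let [j : X -> Y] be an isometric embedding with [Y] of
    the cardinality of [X].  A surjection [g] from [X] onto the unit ball of
    [Y] exists, and [f = j + g] is a 2-isometry whose image spans a dense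
    subspace: [f (n x) / n] tends to [j x], so the closed span contains [j x],
    hence [g x = f x - j x], hence everything.  The operator [T] supplied by
    (a) is therefore defined on all of [Y].  Homogeneity forces [T (j x) = x],
    so [T (g x) = T (f x) - x] is bounded by [2 * gamma]; since [g] exhausts
    the unit ball this bounds the norm of the projection [j \o T].

    From (b) to (a).  Let [f : X -> Y] be a standard eps-isometry with closed
    span [L].  It suffices to find a Banach space [E] of the cardinality of
    [X], an isometric embedding [j : X -> E] and a contraction [S : L -> E]
    with [`|S (f x) - j x| <= 3 * eps]: composing [S] with a projection of [E]
    onto [j X] gives [T] (theorem [gluing]).  The space [E] is the completion
    of [L * X] for the largest seminorm that is at most the sum of the two
    norms and makes every [(f x, - x)] have size at most [3 * eps]
    (theorem [gluing_seminorm]).  Three facts make this work.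

    - [X] keeps its norm in [E].  This amounts to the inequality
      [`|\sum a_i x_i| <= `|\sum a_i f x_i| + 3 eps \sum `|a_i|]
      (theorem [comb_stability]).  Take [w] far out in a direction where the norm
      is almost differentiable along the [x_i].  The path from [f w] to
      [f (- w)] through [f x_i] is then longer than the straight one by a
      multiple of [eps] only, so that [f x_i] can be replaced by [f w] or
      [f (- w)], according to the sign of [a_i], at a cost that is known almost
      exactly.  Approximate differentiability in finitely many directions holds
      densely, by a telescoping sum of second differences along a line.

    - Completions exist: a seminormed space embeds in the bounded functions on
      the set of linear functionals dominated by the seminorm, by the
      Hahn-Banach theorem (theorem [dominated_functional]).  The latter is
      obtained from a minimal sublinear functional.

    - [E] has the cardinality of [X].  Each point of [E] is a limit of a
      sequence indexed by finite combinations of elements of [X], and a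
      Banach space [X] has as many sequences as points (theorem
      [sequences_embed]): both have the cardinality of the sequences in a
      maximal separated subset of the unit ball. *)

(** * Dominated linear functionals *)

Section Sublinear.
Context {R : realType} {V : lmodType R}.
Implicit Types (p q : V -> R) (x y : V).

Definition sublinear p :=
  (forall x y, p (x + y) <= p x + p y) /\
  (forall (t : R) x, 0 <= t -> p (t *: x) = t * p x).

Lemma sublinear0 p : sublinear p -> p 0 = 0.
Proof. by move=> [_ hp]; rewrite -(scale0r 0) hp// mul0r. Qed.

Lemma sublinear_ge p x : sublinear p -> - p (- x) <= p x.
Proof.
move=> sp; have [sub _] := sp; rewrite lerNl -subr_ge0 opprK addrC.
by rewrite -(sublinear0 _ sp) -(subrr x) sub.
Qed.

Lemma sublinear_of_le p :
  (forall x y, p (x + y) <= p x + p y) ->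
  (forall (t : R) x, 0 < t -> p (t *: x) <= t * p x) -> sublinear p.
Proof.
move=> sub hom; split=> // t x; rewrite le_eqVlt => /predU1P[<-|t0].
  rewrite scale0r mul0r.
  have := hom (2^-1) 0 _; have := hom 2 0 _; rewrite !scaler0.
  move=> /(_ (ltr0Sn _ _)) h2 /(_ _); rewrite invr_gt0 => /(_ (ltr0Sn _ _)) h.
  by apply/eqP; rewrite eq_le; apply/andP; split; lra.
apply/eqP; rewrite eq_le hom//= -ler_pdivlMl//.
by rewrite -{1}(scale1r x) -(mulVf (lt0r_neq0 t0)) -scalerA hom// invr_gt0.
Qed.

(** A common source of sublinear functionals: it serves for the tilted
    functional, for lower bounds of chains, and for the seminorm on the glued
    space.  The index [k] depends on the points, which is what lets a single
    statement cover directed families and families stable under sums. *)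
Lemma inf_sublinear (I : Type) (i0 : I) (F : I -> V -> R) :
  (forall x, has_lbound (range (F^~ x))) ->
  (forall i j x y, exists k, F k (x + y) <= F i x + F j y) ->
  (forall i (t : R) x, 0 < t -> exists k, F k (t *: x) <= t * F i x) ->
  sublinear (fun x => inf (range (F^~ x))).
Proof.
move=> lb sub hom.
have ne x : range (F^~ x) !=set0 by exists (F i0 x); exists i0.
have le i x : inf (range (F^~ x)) <= F i x by apply: ge_inf => //; exists i.
apply: sublinear_of_le => [x y|t x t0].
  rewrite -lerBlDr; apply: lb_le_inf => // _ [i _ <-].
  rewrite lerBlDr -lerBlDl; apply: lb_le_inf => // _ [j _ <-].
  by rewrite lerBlDl; have [k] := sub i j x y; exact: le_trans.
rewrite -ler_pdivrMl//; apply: lb_le_inf => // _ [i _ <-].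
by rewrite ler_pdivrMl//; have [k] := hom i t x t0; exact: le_trans.
Qed.

(** The infimum over [t >= 0] of [p (x + t v) - t p v] lowers [p] to a
    sublinear functional that is linear along [v]; the value [t = 1] gives the
    bound at [- v].  It both prescribes the value of a functional at [v] and
    shows that a minimal sublinear functional is odd. *)
Lemma sublinear_tilt p v : sublinear p ->
  exists q, [/\ sublinear q, forall x, q x <= p x & q (- v) <= - p v].
Proof.
move=> sp; have [sub hom] := sp.
pose F (t : R) x := p (x + `|t| *: v) - `|t| * p v.
have lb x : has_lbound (range (F^~ x)).
  exists (- p (- x)) => _ [t _ <-]; rewrite /F -hom// lerBrDr addrC.
  by rewrite lerBlDr (le_trans _ (sub _ _))// addrAC subrr add0r.
exists (fun x => inf (range (F^~ x))); split.
- apply: (inf_sublinear _ 0) => // [s t x y|s t x t0].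
    exists (`|s| + `|t|); rewrite /F ger0_norm ?addr_ge0// mulrDl opprD.
    rewrite addrACA lerD2r scalerDl addrACA; exact: sub.
  exists (t * `|s|); rewrite /F normrM normr_id gtr0_norm// mulrBr mulrA.
  by rewrite -(hom t) ?scalerDr ?scalerA ?lexx ?ltW.
- move=> x; apply: ge_inf => //; exists 0 => //.
  by rewrite /F normr0 scale0r mul0r addr0 subr0.
- apply: ge_inf => //; exists 1 => //.
  by rewrite /F normr1 scale1r mul1r addNr (sublinear0 _ sp) sub0r.
Qed.

(** Zorn's lemma for the reversed pointwise order: a chain is bounded below by
    its infimum, which is finite at [x] because each member [s] satisfies
    [- p (- x) <= - s (- x) <= s x]. *)
Lemma minimal_sublinear p : sublinear p ->
  exists q, [/\ sublinear q, forall x, q x <= p x &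
    forall r, sublinear r -> (forall x, r x <= q x) -> r = q].
Proof.
move=> sp.
pose below q := sublinear q /\ forall x, q x <= p x.
pose T := {q | below q}.
pose le (s t : T) := `[< forall x, sval t x <= sval s x >].
have [| | | |[q [sq qp]] min] := @Zorn T le.
- by move=> s; apply/asboolP.
- move=> r s t /asboolP rs /asboolP st; apply/asboolP => x.
  exact: le_trans (st x) (rs x).
- move=> [s Ps] [t Pt] /asboolP st /asboolP ts; apply: eq_exist.
  by apply/funext => x; apply/eqP; rewrite eq_le ts st.
- (* the empty chain is bounded by p itself *)
  move=> A totA; have [[s0 As0]|A0] := pselect (A !=set0); last first.
    have Pp : sublinear p /\ forall x, p x <= p x by [].
    by exists (exist below p Pp) => s As; case: A0; exists s.
  pose F (i : {s | A s}) := sval (sval i).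
  pose i0 : {s | A s} := exist _ s0 As0.
  have lb x : has_lbound (range (F^~ x)).
    exists (- p (- x)) => _ [[[s [ss sp']] As] _ <-]; rewrite /F/=.
    by rewrite (le_trans _ (sublinear_ge _ x ss))// lerN2.
  have inf_le i x : inf (range (F^~ x)) <= F i x by apply: ge_inf => //; exists i.
  have Pq : sublinear (fun x => inf (range (F^~ x))) /\
      forall x, inf (range (F^~ x)) <= p x.
    split=> [|x]; last by rewrite (le_trans (inf_le i0 x))// /F/=; case: (svalP s0).
    apply: (inf_sublinear _ i0) => // [i j x y|i t x t0].
      have subi k : F k (x + y) <= F k x + F k y.
        by case: k => [[s [[ss hs] ps]] As]; exact: ss.
      case: (totA (sval i) (sval j) (svalP i) (svalP j)) => /asboolP ij.
        by exists j; rewrite (le_trans (subi j))// lerD2r ij.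
      by exists i; rewrite (le_trans (subi i))// lerD2l ij.
    have [[_ hs] _] := svalP (sval i).
    by exists i; rewrite /F hs ?lexx ?ltW.
  exists (exist below _ Pq) => s As; apply/asboolP => x.
  exact: (inf_le (exist _ s As) x).
- exists q; split=> // r sr rq.
  have Pr : sublinear r /\ forall x, r x <= p x.
    by split=> // x; exact: le_trans (rq x) (qp x).
  have /(_ _)/(congr1 sval) := min (exist below r Pr).
  by apply; apply/asboolP => x; exact: rq.
Qed.

(** Hahn-Banach: a minimal sublinear functional [g] below the tilt of [p] along
    [v] cannot be tilted further, so it is odd, hence additive, hence linear;
    domination by the tilt at [- v] forces [g v = p v]. *)
Theorem dominated_functional p v : sublinear p ->
  exists g : V -> R, [/\ forall (a : R) x y, g (a *: x + y) = a * g x + g y,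
    forall x, g x <= p x & g v = p v].
Proof.
move=> sp; have [p' [sp' p'p p'v]] := sublinear_tilt _ v sp.
have [g [sg gp' gmin]] := minimal_sublinear _ sp'.
have [subg homg] := sg.
have gp x : g x <= p x by exact: le_trans (gp' x) (p'p x).
have gN x : g (- x) = - g x.
  have [r [sr rg rx]] := sublinear_tilt _ x sg.
  rewrite -{1}(gmin _ sr rg); apply/eqP; rewrite eq_le rx/=.
  by rewrite (gmin _ sr rg) lerNl (sublinear_ge _ x sg).
have gD x y : g (x + y) = g x + g y.
  apply/eqP; rewrite eq_le subg/=.
  by rewrite -[leLHS]opprK lerNl opprD -!gN opprD subg.
exists g; split=> // [a x y|].
  rewrite gD; congr (_ + _); have [a0|a0] := leP 0 a; first exact: homg.
  by rewrite -[in LHS](opprK a) scaleNr gN homg ?oppr_ge0 ?ltW// mulNr opprK.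
apply/eqP; rewrite eq_le gp/= -[leRHS]opprK lerNr -gN.
exact: le_trans (gp' _) p'v.
Qed.

End Sublinear.

(** * Completion of a seminormed space *)

Section Completion.
Context {R : realType} {V : lmodType R} (p : V -> R) (W : set V).
Hypothesis sp : sublinear p.
Hypothesis pN : forall x, p (- x) = p x.
Hypothesis W0 : W 0.
Hypothesis WZD : forall (a : R) u v, W u -> W v -> W (a *: u + v).

Definition dominated : Type :=
  {g : V -> R | (forall (a : R) x y, g (a *: x + y) = a * g x + g y) /\
                forall x, g x <= p x}.

Definition evaluation (v : V) : dominated -> R^o := fun g => sval g v.

Lemma evaluationZD a u v :
  evaluation (a *: u + v) = a *: evaluation u + evaluation v.
Proof. by apply/funext => -[g [glin gp]]; rewrite /evaluation/= glin. Qed.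

Lemma evaluation0 g : evaluation 0 g = 0.
Proof.
by have := evaluationZD (-1) 0 0; rewrite scaler0 addr0 scaleN1r addNr => ->.
Qed.

Lemma evaluation_le v g : `|evaluation v g| <= p v.
Proof.
have le u : evaluation u g <= p u by case: g => g [glin gp]; exact: gp.
rewrite ler_norml le andbT lerNl -(pN v); apply: le_trans (le (- v)).
by rewrite -[- v]addr0 -scaleN1r evaluationZD !fctE evaluation0 scaleN1r addr0.
Qed.

(** The uniform closure of the evaluations at points of [W].  Its members are
    bounded because they are uniformly close to evaluations. *)
Definition completion_pred : pred (dominated -> R^o) := fun phi =>
  `[< forall e : R, 0 < e ->
      exists2 w, W w & forall g, `|phi g - evaluation w g| <= e >].

Lemma completion_submod_closed : submod_closed completion_pred.
Proof.
split=> [|a phi psi /asboolP hphi /asboolP hpsi]; apply/asboolP => e e0.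
  by exists 0 => // g; rewrite evaluation0 subrr normr0 ltW.
have d0 : 0 < e / 2 / (`|a| + 1) by rewrite !divr_gt0// ltr_wpDl.
have [u Wu hu] := hphi _ d0; have [v Wv hv] := hpsi _ (divr_gt0 e0 (ltr0Sn _ 1)).
exists (a *: u + v); first exact: WZD.
move=> g; rewrite evaluationZD /=.
rewrite (_ : _ - _ = a * (phi g - evaluation u g) + (psi g - evaluation v g)).
  apply: le_trans (ler_normD _ _) _; rewrite [leRHS](splitr e) lerD// normrM.
  apply: (@le_trans _ _ ((`|a| + 1) * (e / 2 / (`|a| + 1)))).
    by apply: ler_pM => //; rewrite lerDl.
  by rewrite mulrCA divff ?mulr1// gt_eqF// ltr_wpDl.
by rewrite !fctE/= /GRing.scale/=; ring.
Qed.

HB.instance Definition _ := GRing.isSubmodClosed.Build R (dominated -> R^o)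
  completion_pred completion_submod_closed.

Record completion :=
  Completion { cval : dominated -> R^o; _ : cval \in completion_pred }.
HB.instance Definition _ := [isSub for cval].
HB.instance Definition _ := [Choice of completion by <:].
HB.instance Definition _ := [SubChoice_isSubLmodule of completion by <:].

(** The supremum of the absolute values is their least upper bound only over an
    inhabited index set. *)
Definition dominated_witness : dominated.
Proof.
have [g [glin gp _]] := cid (dominated_functional p 0 sp).
by exists g.
Defined.

Lemma completionP (phi : completion) (e : R) : 0 < e ->
  exists2 w, W w & forall g, `|cval phi g - evaluation w g| <= e.
Proof. by case: phi => phi /= /asboolP; exact. Qed.

Definition completion_norm (phi : completion) : R :=
  sup (range (fun g => `|cval phi g : R|)).

Lemma completion_norm_has_ubound phi :
  has_ubound (range (fun g => `|cval phi g : R|)).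
Proof.
have [w Ww hw] := completionP phi 1 ltr01; exists (1 + p w) => _ [g _ <-].
rewrite -[cval phi g](subrK (evaluation w g)) (le_trans (ler_normD _ _))//.
by rewrite lerD// evaluation_le.
Qed.

Lemma completion_norm_ge phi g : `|cval phi g : R| <= completion_norm phi.
Proof.
by apply: ub_le_sup; [exact: completion_norm_has_ubound|exists g].
Qed.

Lemma completion_norm_le phi M :
  (forall g, `|cval phi g : R| <= M) -> completion_norm phi <= M.
Proof.
move=> phiM; apply: ge_sup => [|_ [g _ <-]//].
by exists `|cval phi dominated_witness : R|; exists dominated_witness.
Qed.

Lemma cval_additive phi psi g : cval (phi + psi) g = cval phi g + cval psi g.
Proof. by rewrite -[cval (phi + psi)]/(val (phi + psi)) raddfD. Qed.

Lemma cval_scalable (a : R) phi g : cval (a *: phi) g = a * cval phi g.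
Proof. by rewrite -[cval (a *: phi)]/(val (a *: phi)) linearZ. Qed.

Let norm_triangle phi psi :
  completion_norm (phi + psi) <= completion_norm phi + completion_norm psi.
Proof.
apply: completion_norm_le => g; rewrite cval_additive.
by rewrite (le_trans (ler_normD _ _))// lerD// completion_norm_ge.
Qed.

Let norm_scale (a : R) phi :
  completion_norm (a *: phi) = `|a| * completion_norm phi.
Proof.
have le (b : R) psi : completion_norm (b *: psi) <= `|b| * completion_norm psi.
  apply: completion_norm_le => g; rewrite cval_scalable normrM.
  by rewrite ler_wpM2l// completion_norm_ge.
apply/eqP; rewrite eq_le le/=; have [->|a0] := eqVneq a 0.
  by rewrite normr0 mul0r (le_trans _ (completion_norm_ge _ dominated_witness)).
rewrite -ler_pdivlMl ?normr_gt0// -normfV.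
by rewrite -{1}(scale1r phi) -(mulVf a0) -scalerA le.
Qed.

Let norm_eq0 phi : completion_norm phi = 0 -> phi = 0.
Proof.
move=> phi0; apply/val_inj/funext => g; apply/eqP.
by rewrite -normr_le0 -phi0 completion_norm_ge.
Qed.

HB.instance Definition _ :=
  Lmodule_isNormed.Build R completion norm_triangle norm_scale norm_eq0.

(** A Cauchy filter converges at each functional, uniformly in the functional;
    the pointwise limit stays in the closure by the usual three-term estimate. *)
Lemma completion_cauchy_cvg (F : set_system completion) :
  ProperFilter F -> cauchy F -> cvg F.
Proof.
move=> FF /(cauchyP F) Fc.
have {}Fc (e : R) : 0 < e -> exists x, F [set phi : completion | `|x - phi| < e].
  by move=> /Fc[x]; rewrite -ball_normE; exists x.
have diff_le (phi psi : completion) g : `|cval phi g - cval psi g : R| <= `|phi - psi|.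
  by rewrite -mulN1r -cval_scalable scaleN1r -cval_additive completion_norm_ge.
have cvg_at g : cvg ((fun phi : completion => cval phi g : R) @ F).
  apply: cauchy_cvg; apply/cauchyP => e e0; have [x Fx] := Fc _ e0.
  exists (cval x g : R); rewrite nbhs_simpl /=; apply: filterS Fx => phi xphi.
  by rewrite -ball_normE/=; apply: le_lt_trans xphi; exact: diff_le.
pose l (g : dominated) : R^o := lim ((fun phi : completion => cval phi g : R) @ F).
have l_le (e : R) x : 0 < e -> F [set phi | `|x - phi| < e] ->
    forall g, `|l g - cval x g : R| <= e.
  move=> e0 Fx g; apply/ler_addgt0Pr => d d0.
  have := cvg_at g => /cvgrPdist_lt/(_ d d0) Fl.
  have [phi [/= lphi xphi]] := filter_ex (filterI Fl Fx).
  rewrite (_ : _ - _ = (l g - cval phi g) + (cval phi g - cval x g)); last first.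
    by rewrite addrA subrK.
  rewrite (le_trans (ler_normD _ _))// addrC lerD ?(ltW lphi)//.
  by rewrite distrC; apply: le_trans (ltW xphi); exact: diff_le.
have lP : l \in completion_pred.
  apply/asboolP => e e0; have e20 : 0 < e / 2 by rewrite divr_gt0.
  have [x Fx] := Fc _ e20; have [w Ww hw] := completionP x _ e20.
  exists w => // g.
  rewrite (_ : _ - _ = (l g - cval x g) + (cval x g - evaluation w g)); last first.
    by rewrite addrA subrK.
  by rewrite (le_trans (ler_normD _ _))// [leRHS]splitr lerD// (l_le _ _ e20).
apply/cvg_ex; exists (Completion l lP); apply/cvgrPdist_le => e e0.
have e20 : 0 < e / 2 by rewrite divr_gt0.
have [x Fx] := Fc _ e20; apply: filterS (Fx) => phi /= xphi.
apply: completion_norm_le => g.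
rewrite cval_additive -[- phi]scaleN1r cval_scalable mulN1r.
rewrite (_ : _ - _ = (l g - cval x g) + (cval x g - cval phi g)); last first.
  by rewrite addrA subrK.
rewrite (le_trans (ler_normD _ _))// [leRHS]splitr lerD//.
  exact: (l_le _ _ e20).
by apply: le_trans (ltW xphi); exact: diff_le.
Qed.

HB.instance Definition _ := Uniform_isComplete.Build completion
  completion_cauchy_cvg.

Lemma evaluation_completion_pred v : W v -> evaluation v \in completion_pred.
Proof.
move=> Wv; apply/asboolP => e e0; exists v => // g.
by rewrite subrr normr0 ltW.
Qed.

(** The evaluation map preserves the seminorm because each value [p v] is
    attained by a dominated functional. *)
Theorem seminormed_completion :
  exists (E : completeNormedModType R) (h : V -> E),
  [/\ forall (a : R) u v, W u -> W v -> h (a *: u + v) = a *: h u + h v,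
      forall v, W v -> `|h v| = p v &
      forall (z : E) (e : R), 0 < e -> exists2 w, W w & `|z - h w| <= e].
Proof.
pose h v : completion := if pselect (W v) is left Wv then
  Completion (evaluation v) (evaluation_completion_pred v Wv) else 0.
have hE v g : W v -> cval (h v) g = evaluation v g.
  by move=> Wv; rewrite /h; case: pselect.
exists completion, h; split=> [a u v Wu Wv|v Wv|z e e0].
- apply/val_inj/funext => g.
  rewrite -[LHS]/(cval _ g) -[RHS]/(cval _ g) cval_additive cval_scalable.
  rewrite !hE//; last exact: WZD.
  by rewrite evaluationZD.
- apply/eqP; rewrite eq_le completion_norm_le//=; last first.
    by move=> g; rewrite hE// evaluation_le.
  have [g [glin gp gv]] := dominated_functional p v sp.
  pose g' : dominated := exist _ g (conj glin gp).
  apply: le_trans (completion_norm_ge _ g'); rewrite hE// /evaluation/= gv.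
  exact: ler_norm.
- have [w Ww hw] := completionP z _ e0; exists w => //.
  apply: completion_norm_le => g.
  by rewrite cval_additive -[- h w]scaleN1r cval_scalable mulN1r hE.
Qed.

End Completion.

(** * The cardinality of a Banach space *)

Definition embeds (A B : Type) := exists h : A -> B, injective h.

Lemma embeds_trans {A B C : Type} : embeds A B -> embeds B C -> embeds A C.
Proof. by move=> [f fi] [g gi]; exists (g \o f); exact: inj_comp. Qed.

Lemma embeds_fun {A B : Type} : embeds A B -> embeds (nat -> A) (nat -> B).
Proof.
move=> [f fi]; exists (fun u n => f (u n)) => u v uv; apply/funext => n.
by apply: fi; exact: (congr1 (fun w => w n) uv).
Qed.

Lemma embeds_prod {A B C D : Type} :
  embeds A B -> embeds C D -> embeds (A * C) (B * D).
Proof.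
move=> [f fi] [g gi]; exists (fun u => (f u.1, g u.2)).
by move=> [a c] [a' c'] [/fi /= -> /gi /= ->].
Qed.

Lemma embeds_fun_fun {A : Type} : embeds (nat -> nat -> A) (nat -> A).
Proof.
exists (fun u n => if unpickle n is Some ij then u ij.1 ij.2 else u 0%N 0%N).
move=> u v uv; apply/funext => i; apply/funext => j.
by have := congr1 (fun w => w (pickle (i, j))) uv; rewrite /= pickleK.
Qed.

Lemma seq_embeds {A : Type} (a0 : A) : embeds (seq A) (nat * (nat -> A)).
Proof.
exists (fun s => (size s, nth a0 s)) => s t [st nst].
by apply: (@eq_from_nth _ a0) => // i _; rewrite nst.
Qed.

Section BanachCardinality.
Context {R : realType} {X : completeNormedModType R}.

Lemma maximal_separated (r : R) : 0 < r -> exists D : set X,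
  [/\ forall d, D d -> `|d| <= 1,
      forall d d', D d -> D d' -> d <> d' -> r <= `|d - d'| &
      forall x, `|x| <= 1 -> exists2 d, D d & `|x - d| < r].
Proof.
move=> r0; pose P (D : set X) := (forall d, D d -> `|d| <= 1) /\
  forall d d', D d -> D d' -> d <> d' -> r <= `|d - d'|.
have [|D [[D1 Dr] Dmax]] := @Zorn_bigcup X P.
  move=> F FP Ftot; split=> [d [A FA]|d d' [A FA Ad] [A' FA' Ad']].
    by have [+ _] := FP _ FA; exact.
  have [AA'|A'A] := Ftot _ _ FA FA'.
    by have [_ +] := FP _ FA'; apply => //; exact: AA'.
  by have [_ +] := FP _ FA; apply => //; exact: A'A.
exists D; split=> // x x1; apply: contrapT => /forall2NP Dx.
have {}Dx d : D d -> r <= `|x - d|.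
  by move=> Dd; have [//|/negP] := Dx d; rewrite -leNgt.
apply: (Dmax (D `|` [set x])).
  split=> [d Dd|/(_ x (or_intror erefl))/Dx]; first by left.
  by rewrite subrr normr0 leNgt r0.
split=> [d [/D1//|->//]|d d' [Dd|->] [Dd'|->] dd'//].
- exact: Dr.
- by rewrite distrC; exact: Dx.
- exact: Dx.
Qed.

(** Expansion in base 2 with digits in a 1/2-net [D] of the ball: subtracting a
    digit leaves a remainder of norm at most 1/2, which is doubled and expanded
    again.  Two points with the same digits have remainders whose difference is
    multiplied by 2 at each step while staying bounded. *)
Lemma unit_ball_embeds (D : set X) :
  (forall x, `|x| <= 1 -> exists2 d, D d & `|x - d| < 2^-1) ->
  embeds {x : X | `|x| <= 1} (nat -> {d | D d}).
Proof.
move=> Dnet.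
have /choice[dig digP] (x : X) : exists d, `|x| <= 1 -> D d /\ `|x - d| < 2^-1.
  have [/Dnet[d]|nx] := pselect (`|x| <= 1); last by exists 0 => /nx.
  by exists d.
pose rem (x : X) n := iter n (fun y => 2 *: (y - dig y)) x.
have remS x n : rem x n.+1 = 2 *: (rem x n - dig (rem x n)) by [].
have rem1 x n : `|x| <= 1 -> `|rem x n| <= 1.
  move=> x1; elim: n => // n IH; rewrite remS.
  have [_ lt2] := digP _ IH.
  rewrite normrZ ger0_norm// -ler_pdivlMl// mulr1; exact: ltW.
have digD (x : {x : X | `|x| <= 1}) n : D (dig (rem (sval x) n)).
  by have [] := digP _ (rem1 _ n (svalP x)).
exists (fun x n => exist _ _ (digD x n)) => -[x x1] [y y1] xy.
have remB n : rem x n - rem y n = 2 ^+ n *: (x - y).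
  elim: n => [|n IH]; first by rewrite scale1r.
  have eqd : dig (rem x n) = dig (rem y n).
    by have /(congr1 sval) := congr1 (fun w => w n) xy.
  rewrite !remS eqd.
  by rewrite -scalerBr opprB addrA subrK IH scalerA exprS.
apply: eq_exist; apply/eqP; rewrite -subr_eq0 -normr_le0 leNgt; apply/negP => xy0.
have [n] : exists n, 2 / `|x - y| < n%:R.
  by exists (Num.truncn (2 / `|x - y|)).+1; rewrite truncnS_gt.
rewrite ltr_pdivrMr// ltNge => /negP; apply.
have := ler_normD (rem x n) (- rem y n); rewrite remB normrN normrZ.
rewrite ger0_norm ?exprn_ge0// => h.
apply: (@le_trans _ _ (2 ^+ n * `|x - y|)).
  rewrite ler_wpM2r// -natrX ler_nat; exact: ltnW (ltn_expl _ _).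
by rewrite (le_trans h)// (natrD _ 1 1) lerD// rem1.
Qed.

(** The map sending [u] to the sum of [10^-n u_n] is injective: the tail of the
    series contributes at most 2/9 to the difference of two values, less than
    the separation 1/2 of distinct leading terms, so a common value determines
    the leading term and then, by shifting, all the others. *)
Lemma separated_sequences_embed (D : set X) :
  (forall d, D d -> `|d| <= 1) ->
  (forall d d', D d -> D d' -> d <> d' -> 2^-1 <= `|d - d'|) ->
  embeds (nat -> {d | D d}) X.
Proof.
move=> D1 Dsep.
pose term (u : nat -> {d | D d}) n : X := 10^-1 ^+ n *: sval (u n).
have term_le u n : `|term u n| <= geometric 1 10^-1 n.
  rewrite normrZ ger0_norm ?exprn_ge0// /geometric/= mul1r.
  by rewrite ler_piMr ?exprn_ge0// D1//; exact: svalP.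
have c1 : `|10^-1 : R| < 1 by rewrite ger0_norm// invf_lt1// ltr1n.
have cvg_norm u : cvgn [normed series (term u)].
  apply: (series_le_cvg _ _ (term_le u)) => //.
    by move=> n; rewrite /= mul1r exprn_ge0.
  exact: is_cvg_geometric_series.
pose sum u : X := limn (series (term u)).
have cvg_sum u : cvgn (series (term u)) by exact: normed_cvg.
have sum_le u : `|sum u| <= 10 / 9.
  apply: le_trans (lim_series_norm (cvg_norm u)) _.
  apply: le_trans (lim_series_le (cvg_norm u) _ (term_le u)) _.
    exact: is_cvg_geometric_series.
  rewrite (cvg_lim _ (@cvg_geometric_series _ 1 _ c1))//.
  suff -> : 1 * (1 - 10^-1)^-1 = 10 / 9 :> R by [].
  by field.
pose shift (u : nat -> {d | D d}) n := u n.+1.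
have sumE u : sum u = sval (u 0%N) + 10^-1 *: sum (shift u).
  apply: (@cvg_lim _ _ _ _ _ _ _) => //.
  rewrite -cvg_shiftS.
  rewrite (_ : (fun n => _) =
      fun n => sval (u 0%N) + 10^-1 *: series (term (shift u)) n); last first.
    apply/funext => n; rewrite seriesEnat/= big_nat_recl// seriesEnat/= {1}/term.
    rewrite expr0 scale1r scaler_sumr; congr (_ + _); apply: eq_bigr => i _.
    by rewrite /term scalerA -exprS.
  apply: cvgD; first exact: cvg_cst.
  by apply: cvgZr; exact: cvg_sum.
have head u v : sum u = sum v -> u 0%N = v 0%N.
  rewrite (sumE u) (sumE v) => uv; apply: contrapT => uv0.
  have {}uv : sval (u 0%N) - sval (v 0%N) = 10^-1 *: (sum (shift v) - sum (shift u)).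
    by rewrite scalerBr; apply/eqP; rewrite subr_eq addrAC eq_sym subr_eq addrC uv.
  have uv0' : sval (u 0%N) <> sval (v 0%N).
    move: (u 0%N) (v 0%N) uv0 => [a Da] [b Db] /= ab h; apply: ab; exact: eq_exist.
  have := Dsep _ _ (svalP (u 0%N)) (svalP (v 0%N)) uv0'.
  rewrite uv normrZ ger0_norm//.
  have := ler_normB (sum (shift v)) (sum (shift u)).
  have := sum_le (shift v); have := sum_le (shift u); lra.
have tail u v : sum u = sum v -> sum (shift u) = sum (shift v).
  move=> uv; have := uv; rewrite (sumE u) (sumE v) (head _ _ uv) => /addrI.
  by apply: scalerI; rewrite invr_eq0.
exists sum => u v uv; apply/funext => n.
elim: n u v uv => [|n IH] u v uv; first exact: head.
exact: IH (tail _ _ uv).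
Qed.

Lemma Banach_embeds_unit_ball : embeds X {x : X | `|x| <= 1}.
Proof.
have h (x : X) : `|(1 + `|x|)^-1 *: x| <= 1.
  rewrite normrZ ger0_norm ?invr_ge0 ?addr_ge0//.
  by rewrite mulrC ler_pdivrMr ?mul1r ?lerDr// ltr_pwDl.
exists (fun x => exist (fun z : X => `|z| <= 1) _ (h x)) => x y [] xy.
have pos (z : X) : 0 < 1 + `|z| by rewrite ltr_pwDl.
have xyn : `|x| = `|y|.
  have := congr1 Num.norm xy; rewrite !normrZ !gtr0_norm ?invr_gt0// => /eqP.
  rewrite !(mulrC _^-1) eqr_div ?lt0r_neq0// => /eqP; rewrite !mulrDr !mulr1.
  by rewrite (mulrC `|y|) => /addIr.
have := congr1 (fun z => (1 + `|x|) *: z) xy.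
by rewrite /= {3}xyn !scalerA !mulfV ?gt_eqF// !scale1r.
Qed.

(** A maximal 1/2-separated subset [D] of the unit ball is a 1/2-net, so
    [nat -> D] is both large enough to receive [X] and small enough to embed in
    [X]; and sequences in [nat -> D] are double sequences in [D], which can be
    coded as simple ones. *)
Theorem sequences_embed : embeds (nat -> X) X.
Proof.
have [|D [D1 Dsep Dnet]] := maximal_separated 2^-1; first by rewrite invr_gt0.
have XD := embeds_trans Banach_embeds_unit_ball (unit_ball_embeds _ Dnet).
apply: embeds_trans (separated_sequences_embed _ D1 Dsep).
exact: embeds_trans (embeds_fun XD) embeds_fun_fun.
Qed.

End BanachCardinality.

(** * Stability of linear combinations *)

Section FlatPoints.
Context {R : realType} {X : normedModType R}.
Implicit Types (x y z v : X) (s e d : R).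

(** Almost differentiability of the norm at [y] along [v], at scale [s]: for a
    convex function the second difference controls the gap between the left and
    the right slope. *)
Definition flat e s v y := `|y + s *: v| + `|y - s *: v| - 2 * `|y| < e * s.

(** On the line through [x] the slopes of the norm increase and stay between
    [- `|v|] and [`|v|].  Along [n] consecutive points where flatness fails they
    would increase by [n * e] in total, which is too much for large [n]. *)
Lemma flat_near_line x v e d : 0 < e -> 0 < d ->
  exists y s, [/\ 0 < s, `|y - x| < d & flat e s v y].
Proof.
move=> e0 d0.
have [n cn] : exists n, 2 * `|v| < n%:R * e.
  by exists (Num.truncn (2 * `|v| / e)).+1; rewrite -ltr_pdivrMr// truncnS_gt.
have D0 : 0 < n%:R * `|v| + 1 by rewrite ltr_wpDl// mulr_ge0.
pose s := d / (n%:R * `|v| + 1).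
have s0 : 0 < s by rewrite divr_gt0.
pose y k : X := x + (k%:R * s) *: v.
have yS k : y k.+1 = y k + s *: v.
  by rewrite /y -addrA -scalerDl -natr1 mulrDl mul1r.
apply: contrapT => noflat.
have steep k : (k < n)%N -> `|y k.+2| - `|y k.+1| >= `|y k.+1| - `|y k| + e * s.
  move=> kn; rewrite leNgt; apply/negP => lt; apply: noflat.
  exists (y k.+1), s; split=> //.
    rewrite /y addrC addKr normrZ ger0_norm ?mulr_ge0// ?ltW//.
    apply: (@le_lt_trans _ _ (n%:R * `|v| * s)).
      by rewrite mulrAC ler_pM2r// ler_wpM2r// ler_nat.
    by rewrite /s mulrCA -[ltRHS]mulr1 ltr_pM2l// ltr_pdivrMr// mul1r ltrDl.
  by rewrite /flat -yS {1}(yS k) addrK; lra.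
have slope k : (k <= n)%N -> `|y k.+1| - `|y k| >= - (s * `|v|) + k%:R * (e * s).
  elim: k => [|k IH] kn.
    rewrite mul0r addr0 yS.
    have := ler_normB (y 0%N + s *: v) (s *: v).
    by rewrite addrK normrZ gtr0_norm//; lra.
  have := IH (ltnW kn); have := steep _ kn; rewrite -natr1 mulrDl mul1r; lra.
have := slope n (leqnn n); have := ler_normD (y n) (s *: v).
rewrite -yS normrZ gtr0_norm// => h1 h2.
have : n%:R * e * s <= 2 * `|v| * s by rewrite -mulrA; lra.
by rewrite ler_pM2r// leNgt cn.
Qed.

Lemma flat_shrink e s r v y : 0 < r -> r <= s -> flat e s v y -> flat e r v y.
Proof.
move=> r0 rs; have s0 : 0 < s by exact: lt_le_trans rs.
rewrite /flat => fl; pose t := r / s.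
have t0 : 0 < t by rewrite divr_gt0.
have t1 : 0 <= 1 - t by rewrite subr_ge0 ler_pdivrMr// mul1r.
have conv w : `|y + r *: w| <= (1 - t) * `|y| + t * `|y + s *: w|.
  rewrite (_ : y + r *: w = (1 - t) *: y + t *: (y + s *: w)).
    rewrite (le_trans (ler_normD _ _))// 2!normrZ (ger0_norm t1).
    by rewrite (gtr0_norm t0).
  by rewrite scalerDr scalerA divfK ?gt_eqF// addrA -scalerDl subrK scale1r.
have := conv v; have := conv (- v); rewrite !scalerN => h1 h2.
have : t * (`|y + s *: v| + `|y - s *: v| - 2 * `|y|) < t * (e * s).
  by rewrite ltr_pM2l.
by rewrite (_ : t * (e * s) = e * r); [lra|rewrite /t; field; rewrite gt_eqF].
Qed.

Lemma flat_open e s v y : flat e s v y ->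
  exists2 d, 0 < d & forall z, `|z - y| < d -> flat e s v z.
Proof.
rewrite /flat => fl.
exists ((e * s - (`|y + s *: v| + `|y - s *: v| - 2 * `|y|)) / 4).
  by rewrite divr_gt0// subr_gt0.
move=> z zy.
have h1 w : `|z + w| <= `|y + w| + `|z - y|.
  rewrite (_ : z + w = (y + w) + (z - y)) ?ler_normD//.
  by rewrite [RHS]addrC addrA subrK.
have := h1 (s *: v); have := h1 (- (s *: v)).
have := ler_normD z (y - z); rewrite subrKC (distrC y z); lra.
Qed.

(** Flatness along one direction holds on a dense open set, so finitely many
    directions can be treated one after the other inside shrinking balls; a
    common scale exists because flatness passes to smaller scales. *)
Lemma flat_dense (l : seq X) x e d : 0 < e -> 0 < d ->
  exists y s, [/\ 0 < s, `|y - x| < d & forall v, v \in l -> flat e s v y].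
Proof.
move=> e0 d0.
(* the induction carries a whole ball of flat points, not just its center *)
suff [y [s [r [s0 r0 H]]]] : exists y s r, [/\ 0 < s, 0 < r & forall z,
    `|z - y| < r -> `|z - x| < d /\ forall v, v \in l -> flat e s v z].
  by exists y, s; have [|yx yl] := H y; [rewrite subrr normr0|split].
elim: l => [|v l [y [s [r [s0 r0 H]]]]]; first by exists x, 1, d.
have [y' [s' [s'0 y'y fl]]] := flat_near_line y v e r e0 r0.
have [r' r'0 fl'] := flat_open _ _ _ _ fl.
exists y', (Num.min s s'), (Num.min r' (r - `|y' - y|)); split.
- by rewrite lt_min s0.
- by rewrite lt_min r'0 subr_gt0.
move=> z; rewrite lt_min => /andP[zr' zr].
have [|zx zl] := H z.
  by rewrite -(subrK y' z) -addrA (le_lt_trans (ler_normD _ _))// -ltrBrDr.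
split=> // u; have m0 : 0 < Num.min s s' by rewrite lt_min s0.
rewrite in_cons => /predU1P[->|ul].
  by apply: flat_shrink (fl' _ zr') => //; rewrite ge_min lexx orbT.
by apply: flat_shrink (zl _ ul) => //; rewrite ge_min lexx.
Qed.

End FlatPoints.

Section Combinations.
Context {R : realType} {X Y : normedModType R} (f : X -> Y) (eps : R).
Hypothesis eps0 : 0 <= eps.
Hypothesis fiso : standard_eps_isometry eps f.
Implicit Types (l : seq (R * X)).

Definition comb {V : lmodType R} (g : X -> V) l : V :=
  \sum_(c <- l) c.1 *: g c.2.

Definition weight l : R := \sum_(c <- l) `|c.1|.

Lemma weight_ge0 l : 0 <= weight l. Proof. exact: sumr_ge0. Qed.

Lemma isometry_upper x y : `|f x - f y| <= `|x - y| + eps.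
Proof. by have [_ /(_ x y)] := fiso; rewrite ler_norml => /andP[_]; lra. Qed.

Lemma isometry_lower x y : `|x - y| - eps <= `|f x - f y|.
Proof. by have [_ /(_ x y)] := fiso; rewrite ler_norml => /andP[+ _]; lra. Qed.

Lemma isometry_norm x : `|f x| <= `|x| + eps.
Proof. by have := isometry_upper x 0; have [-> _] := fiso; rewrite !subr0. Qed.

(** The larger of [a] and [b] multiplies the difference [f w - f (- w)], of norm
    about [2 * `|w|], and the excess multiplies a vector of norm about [`|w|];
    what remains is [(a + b) * `|w|] up to the errors. *)
Lemma antipodal_comb_ge w (a b : R) : 0 <= a -> 0 <= b ->
  (a + b) * (`|w| - 2 * eps) <= `|a *: f w - b *: f (- w)|.
Proof.
have low : 2 * `|w| - eps <= `|f w - f (- w)|.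
  apply: le_trans (isometry_lower w (- w)).
  by rewrite opprK -mulr2n normrMn mulr_natl.
have up z : `|z| = `|w| -> `|f z| <= `|w| + eps by move=> <-; exact: isometry_norm.
move=> a0 b0; have [ba|/ltW ab] := leP b a.
  have ba0 : 0 <= a - b by rewrite subr_ge0.
  rewrite (_ : _ - _ = a *: (f w - f (- w)) + (a - b) *: f (- w)); last first.
    by rewrite scalerBr scalerBl addrA subrK.
  apply: le_trans (lerB_normD _ _); rewrite 2!normrZ (ger0_norm a0) (ger0_norm ba0).
  have := ler_wpM2l a0 low; have := ler_wpM2l ba0 (up _ (normrN w)).
  have := mulr_ge0 b0 eps0; lra.
have ab0 : 0 <= b - a by rewrite subr_ge0.
rewrite (_ : _ - _ = b *: (f w - f (- w)) - (b - a) *: f w); last first.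
  by rewrite scalerBr scalerBl opprB [RHS]addrC addrA subrK.
apply: le_trans (lerB_normD _ _); rewrite normrN 2!normrZ (ger0_norm b0) (ger0_norm ab0).
have := ler_wpM2l b0 low; have := ler_wpM2l ab0 (up _ (erefl `|w|)).
have := mulr_ge0 a0 eps0; lra.
Qed.

(** Each [f x] is compared with [f w] when its coefficient [c] is nonnegative
    and with [f (- w)] when [c] is negative.  In both cases flatness bounds the
    cost of the replacement, [`|c|] times the distance from [x] to [w] or
    [- w], by [`|c| * (2 * `|w| + e) - `| `|c| *: w + c *: x|].  The subtracted
    terms add up, by the triangle inequality, to the norm of the combination of
    the [x] shifted by [weight l *: w]. *)
Lemma comb_near_antipodal l w (e : R) :
  (forall c, c \in l -> `|w + c.2| + `|w - c.2| - 2 * `|w| <= e) ->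
  exists a b : R, [/\ 0 <= a, 0 <= b, a + b = weight l &
    `|a *: f w - b *: f (- w) - comb f l| <=
    weight l * (2 * `|w| + e + eps) - `|weight l *: w + comb id l|].
Proof.
rewrite /weight /comb; elim: l => [_|[c x] l IH fl].
  exists 0, 0; split; rewrite ?big_nil ?addr0//.
  by rewrite !scale0r !subr0 mul0r !normr0 subrr.
have [z zl|a [b [a0 b0 ab H]]] := IH.
  by apply: fl; rewrite in_cons zl orbT.
have := fl (c, x); rewrite mem_head => /(_ isT)/= flx.
rewrite !big_cons; set A := \sum_(j <- l) `|j.1| in H ab *.
set S := \sum_(j <- l) _ *: id j.2 in H *; set T := \sum_(j <- l) _ *: f j.2 in H *.
rewrite /=.
have tri : `|(`|c| + A) *: w + (c *: x + S)| <=
    `| `|c| *: w + c *: x| + `|A *: w + S|.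
  by rewrite scalerDl addrACA ler_normD.
have {}flx := ler_wpM2l (normr_ge0 c) flx.
have [c0|/ltW c0] := leP 0 c.
  exists (c + a), b; split=> //; [exact: addr_ge0|by rewrite -addrA ab ger0_norm|].
  rewrite (_ : _ - _ = c *: (f w - f x) + (a *: f w - b *: f (- w) - T)).
    apply: le_trans (ler_normD _ _) _; rewrite normrZ.
    have := ler_wpM2l (normr_ge0 c) (isometry_upper w x).
    have : `| `|c| *: w + c *: x| = `|c| * `|w + x|.
      by rewrite -normrZ (ger0_norm c0) scalerDr.
    lra.
  by rewrite scalerDl scalerBr opprD [RHS]addrACA -[in LHS](addrA (c *: f w)).
exists a, (b - c); split=> //.
- by rewrite subr_ge0 (le_trans c0).
- by rewrite addrA ab (ler0_norm c0) addrC.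
rewrite (_ : _ - _ = c *: (f (- w) - f x) + (a *: f w - b *: f (- w) - T)).
  apply: le_trans (ler_normD _ _) _; rewrite normrZ.
  have := ler_wpM2l (normr_ge0 c) (isometry_upper (- w) x).
  rewrite -opprD normrN.
  have : `| `|c| *: w + c *: x| = `|c| * `|w - x|.
    by rewrite -normrZ (ler0_norm c0) scalerBr scaleNr addrC distrC.
  lra.
by rewrite scalerBl scalerBr opprB opprD [RHS]addrACA; congr (_ + _); exact: addrCA.
Qed.

(** Take [x] flat in all directions of [l], close to the combination [v] itself,
    and [w] a positive multiple of [x].  Since [w] points almost in the direction
    of [v], adding [v] to [weight l *: w] increases the norm by almost [`|v|],
    while the two previous lemmas bound this increase by the norm of the
    combination of the images, up to [3 * eps * weight l]. *)
Theorem comb_stability l : `|comb id l| <= `|comb f l| + 3 * eps * weight l.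
Proof.
set v := comb id l; set y := comb f l; set A := weight l.
have A0 : 0 <= A := weight_ge0 l.
apply/ler_addgt0Pr => e e0.
(* the final error is 2 * d + A * h *)
pose h := e / (2 * (A + 1)); pose d := e / 4.
have A1 : 0 < A + 1 by rewrite ltr_wpDl.
have h0 : 0 < h by rewrite divr_gt0// mulr_gt0.
have d0 : 0 < d by rewrite divr_gt0.
have Ah : A * h <= e / 2.
  rewrite (_ : A * h = e / 2 - h) ?lerBlDr ?lerDl ?ltW//.
  by rewrite /h; field; rewrite gt_eqF.
have [x [s [s0 xv fl]]] := flat_dense [seq c.2 | c <- l] v h d h0 d0.
(* dilating by t = 1 / s turns flatness at scale s into flatness at scale 1 *)
have [t t0 ts] : exists2 t, 0 < t & t * s = 1.
  by exists s^-1; rewrite ?invr_gt0 ?mulVf ?gt_eqF.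
pose w := t *: x.
have flw c : c \in l -> `|w + c.2| + `|w - c.2| - 2 * `|w| <= h.
  move=> cl; have {fl}fl := fl _ (map_f _ cl).
  have E u : `|w + u| = t * `|x + s *: u|.
    by rewrite -[t in RHS](gtr0_norm t0) -normrZ scalerDr scalerA ts scale1r.
  rewrite !E scalerN /w normrZ (gtr0_norm t0).
  have : t * (`|x + s *: c.2| + `|x - s *: c.2| - 2 * `|x|) <= t * (h * s).
    by rewrite ler_pM2l// ltW.
  by rewrite mulrCA ts mulr1; lra.
have [a [b [a0 b0 ab H]]] := comb_near_antipodal l w h flw.
have := antipodal_comb_ge w a b a0 b0; rewrite ab -/A => low.
rewrite -/A -/v -/y in H.
have tri : `|a *: f w - b *: f (- w)| <= `|a *: f w - b *: f (- w) - y| + `|y|.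
  by rewrite -{1}(subrK y (a *: f w - b *: f (- w))) ler_normD.
have Aw : A * `|w| + `|x| - d <= `|A *: w + v|.
  have wE : `|A *: w + x| = A * `|w| + `|x|.
    rewrite /w scalerA -{2}(scale1r x) -scalerDl !normrZ !ger0_norm//.
    - by rewrite mulrDl mul1r mulrA.
    - exact: ltW.
    - by rewrite addr_ge0// mulr_ge0// ltW.
  rewrite -wE; have := ler_normD (A *: w + v) (x - v).
  by rewrite (_ : A *: w + v + (x - v) = A *: w + x); [lra|rewrite -addrA subrKC].
have vx : `|v| <= `|x| + d.
  have := ler_normD x (v - x); rewrite subrKC distrC; lra.
rewrite /d in vx Aw; lra.
Qed.

End Combinations.

(** * The span of the image *)

Section Span.
Context {R : realType} {X Y : normedModType R} (f : X -> Y).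
Implicit Types (l : seq (R * X)).

Definition scale_coeffs (a : R) l : seq (R * X) := [seq (a * c.1, c.2) | c <- l].

Lemma comb_cat {V : lmodType R} (g : X -> V) l l' :
  comb g (l ++ l') = comb g l + comb g l'.
Proof. by rewrite /comb big_cat. Qed.

Lemma comb_scale {V : lmodType R} (g : X -> V) a l :
  comb g (scale_coeffs a l) = a *: comb g l.
Proof.
by rewrite /comb big_map scaler_sumr; apply: eq_bigr => c _; rewrite scalerA.
Qed.

Lemma weight_cat l l' : weight (l ++ l') = weight l + weight l'.
Proof. by rewrite /weight big_cat. Qed.

Lemma weight_scale a l : weight (scale_coeffs a l) = `|a| * weight l.
Proof.
by rewrite /weight big_map mulr_sumr; apply: eq_bigr => c _; rewrite normrM.
Qed.

Lemma linear_span_comb v :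
  linear_span (range f) v <-> exists l, v = comb f l.
Proof.
split=> [[n [c [s [sf ->]]]]|[l ->]].
  have /choice[x xP] i : exists x, f x = s i by have [x _ <-] := sf i; exists x.
  exists [seq (c i, x i) | i <- enum 'I_n].
  rewrite /comb big_map big_enum; apply: eq_bigr => i _.
  by rewrite /= xP.
exists (size l), (fun i => (nth (0, 0) l i).1), (fun i => f (nth (0, 0) l i).2).
split=> [i|]; first by exists (nth (0, 0) l i).2.
by rewrite /comb (big_nth (0, 0)) big_mkord.
Qed.

Lemma closed_spanP v : closed_span (range f) v <->
  forall e : R, 0 < e -> exists l, `|v - comb f l| <= e.
Proof.
split=> [cl e e0|H B /nbhs_ballP[e /= e0 eB]].
  have [u [/linear_span_comb[l ->]]] := cl _ (nbhsx_ballx v e e0).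
  by rewrite -ball_normE/= => /ltW; exists l.
have [l lv] := H _ (divr_gt0 e0 (ltr0Sn _ 1)).
exists (comb f l); split; first by apply/linear_span_comb; exists l.
apply: eB; rewrite -ball_normE/= (le_lt_trans lv)// ltr_pdivrMr// ltr_pMr//.
by rewrite ltr1n.
Qed.

Lemma closed_span_image x : closed_span (range f) (f x).
Proof.
apply/closed_spanP => e e0; exists [:: (1, x)].
by rewrite /comb big_seq1 scale1r subrr normr0 ltW.
Qed.

Lemma closed_span0 : closed_span (range f) 0.
Proof.
by apply/closed_spanP => e e0; exists [::]; rewrite /comb big_nil subrr normr0 ltW.
Qed.

Lemma closed_spanZD (a : R) u v : closed_span (range f) u ->
  closed_span (range f) v -> closed_span (range f) (a *: u + v).
Proof.
move=> /closed_spanP hu /closed_spanP hv; apply/closed_spanP => e e0.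
have a0 : 0 < `|a| + 1 by rewrite ltr_wpDl.
have e20 : 0 < e / 2 by rewrite divr_gt0.
have [l lu] := hu _ (divr_gt0 e20 a0); have [l' lv] := hv _ e20.
exists (scale_coeffs a l ++ l'); rewrite comb_cat comb_scale opprD addrACA -scalerBr.
rewrite (le_trans (ler_normD _ _))// [leRHS]splitr lerD// normrZ.
rewrite (le_trans (ler_wpM2l _ lu))// mulrCA ler_piMr ?ltW//.
by rewrite ltr_pdivrMr// mul1r ltrDl.
Qed.

End Span.

(** * Gluing a space to the span of an almost isometric image *)

Section Pushout.
Context {R : realType} {X Y : normedModType R} (f : X -> Y) (eps : R).
Hypothesis eps0 : 0 <= eps.
Hypothesis fiso : standard_eps_isometry eps f.
Implicit Types (l : seq (R * X)).

(** The infimum, over all finite combinations [l], of the cost of moving [l]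
    from one factor to the other.  Moving nothing gives the upper bounds; that
    [X] keeps its norm is exactly the stability of combinations. *)
Theorem gluing_seminorm : exists q : Y * X -> R,
  [/\ sublinear q, forall v, q (- v) = q v, forall u, q (0, u) = `|u|,
      forall y u, q (y, u) <= `|y| + `|u| &
      forall x, q (f x, - x) <= 3 * eps].
Proof.
pose F l (v : Y * X) :=
  `|v.1 - comb f l| + `|v.2 + comb id l| + 3 * eps * weight l.
have F0 l v : 0 <= F l v.
  by rewrite !addr_ge0// mulr_ge0 ?weight_ge0// mulr_ge0.
have lb v : has_lbound (range (F^~ v)) by exists 0 => _ [l _ <-].
have FZ (a : R) l v : F (scale_coeffs a l) (a *: v) = `|a| * F l v.
  rewrite /F !comb_scale weight_scale /= -scalerBr -scalerDr !normrZ; ring.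
pose q v := inf (range (F^~ v)).
have q_le l v : q v <= F l v by apply: ge_inf => //; exists l.
have le_q v m : (forall l, m <= F l v) -> m <= q v.
  by move=> h; apply: lb_le_inf => [|_ [l _ <-]//]; exists (F [::] v), [::].
have nilE y u : F [::] (y, u) = `|y| + `|u|.
  by rewrite /F /comb /weight !big_nil/= subr0 addr0 mulr0 addr0.
exists q; split.
- apply: (inf_sublinear _ [::]) => // [l l' v w|l t v t0].
    exists (l ++ l'); rewrite /F !comb_cat weight_cat /= opprD addrACA.
    rewrite (addrACA v.2) mulrDr.
    have := ler_normD (v.1 - comb f l) (w.1 - comb f l').
    have := ler_normD (v.2 + comb id l) (w.2 + comb id l').
    lra.
  by exists (scale_coeffs t l); rewrite FZ gtr0_norm.
- have le v : q (- v) <= q v.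
    apply: le_q => l; have := q_le (scale_coeffs (-1) l) (- v).
    by rewrite -[- v]scaleN1r FZ normrN1 mul1r.
  by move=> v; apply/eqP; rewrite eq_le le -{1}[v]opprK le.
- move=> u; apply/eqP; rewrite eq_le; apply/andP; split.
    by apply: le_trans (q_le [::] _) _; rewrite nilE normr0 add0r.
  apply: le_q => l; rewrite /F /= sub0r normrN.
  have := ler_normB (u + comb id l) (comb id l); rewrite addrK.
  have := comb_stability f eps eps0 fiso l; lra.
- by move=> y u; rewrite -nilE.
- move=> x; apply: le_trans (q_le [:: (1, x)] _) _.
  rewrite /F /comb /weight !big_seq1/= !scale1r subrr addNr !normr0 normr1.
  by rewrite !add0r mulr1.
Qed.

End Pushout.

Section Gluing.
Context {R : realType} {X Y : completeNormedModType R} (f : X -> Y) (eps : R).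
Hypothesis eps0 : 0 <= eps.
Hypothesis fiso : standard_eps_isometry eps f.

(** Codes for the elements of a dense subset of the glued space. *)
Lemma coefficients_embed (x0 : X) : x0 != 0 -> embeds (seq (R * X) * X) X.
Proof.
move=> x00.
have RX : embeds R X.
  exists (fun r => r *: x0) => r s /eqP; rewrite -subr_eq0 -scalerBl.
  by rewrite scaler_eq0 (negPf x00) orbF subr_eq0 => /eqP.
have NX : embeds nat X.
  apply: (embeds_trans _ RX); exists (fun n => n%:R) => m n /eqP.
  by rewrite eqr_nat => /eqP.
have XX : embeds (X * X) X.
  apply: (embeds_trans _ sequences_embed).
  exists (fun u n => if n is 0 then u.1 else u.2) => -[a b] [c d] h.
  by have := congr1 (fun w => w 0%N) h; have := congr1 (fun w => w 1%N) h => /= -> ->.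
have X1 : embeds X X by exists id.
apply: (embeds_trans _ XX); apply: embeds_prod => //.
apply: embeds_trans (seq_embeds (0, 0)) _.
apply: (embeds_trans _ XX); apply: embeds_prod => //.
apply: (embeds_trans _ sequences_embed); apply: embeds_fun.
by apply: (embeds_trans _ XX); exact: embeds_prod.
Qed.

(** The completion of [L * X], with [L] the closed span of the image, for the
    gluing seminorm.  Its points are limits of sequences of coded elements, one
    code for each precision, so it is no larger than the set of sequences in
    [X]. *)
Theorem gluing (x0 : X) : x0 != 0 ->
  exists (E : completeNormedModType R) (j : {linear X -> E}) (S : Y -> E),
  [/\ forall x, `|j x| = `|x|,
      forall (a : R) u v, closed_span (range f) u -> closed_span (range f) v ->
        S (a *: u + v) = a *: S u + S v,
      forall y, closed_span (range f) y -> `|S y| <= `|y|,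
      forall x, `|S (f x) - j x| <= 3 * eps &
      ([set: E] #= [set: X])%card].
Proof.
move=> x00; have [q [sq qN q0 q_le qf]] := gluing_seminorm f eps eps0 fiso.
pose W (v : Y * X) := closed_span (range f) v.1.
have W0 u : W (0, u) by exact: closed_span0.
have WZD (a : R) u v : W u -> W v -> W (a *: u + v) by exact: closed_spanZD.
have [E [h [hZD hq hdense]]] := seminormed_completion q W sq qN (W0 0) WZD.
have jlin : linear (fun u => h (0, u)).
  move=> a u v; rewrite -hZD//; congr h.
  by apply/pair_equal_spec; rewrite /= scaler0 addr0.
have [j jE] : exists j : {linear X -> E}, forall u, j u = h (0, u).
  pose jmix := GRing.isLinear.Build R X E *:%R (fun u => h (0, u)) jlin.
  pose j : {linear X -> E} := HB.pack (fun u => h (0, u)) jmix.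
  by exists j.
exists E, j, (fun y => h (y, 0)); split.
- by move=> x; rewrite jE hq.
- move=> a u v Lu Lv; rewrite -hZD//; congr h.
  by apply/pair_equal_spec; rewrite /= scaler0 addr0.
- by move=> y Ly; rewrite hq// (le_trans (q_le _ _))// normr0 addr0.
- move=> x; rewrite jE addrC -scaleN1r -hZD//; last exact: closed_span_image.
  rewrite hq; last by apply: WZD => //; exact: closed_span_image.
  rewrite (_ : _ + _ = (f x, - x)) //; apply/pair_equal_spec.
  by rewrite /= scaler0 add0r addr0 scaleN1r.
- apply: Cantor_Bernstein; apply/pcard_injP; last first.
    exists j => x y _ _ jxy; apply/eqP; rewrite -subr_eq0 -normr_eq0.
    by rewrite -q0 -hq// -jE linearB jxy subrr normr0.
  suff [c ci] : embeds E X by exists c => u v _ _ /ci.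
  apply: (embeds_trans _ sequences_embed).
  apply: (embeds_trans _ (embeds_fun (coefficients_embed x0 x00))).
  have approx (z : E) n : exists c : seq (R * X) * X,
      `|z - h (comb f c.1, c.2)| <= 2 * n.+1%:R^-1.
    have n0 : 0 < n.+1%:R^-1 :> R by rewrite invr_gt0.
    have [[y u] /= Wyu zyu] := hdense z _ n0.
    have [l yl] := (closed_spanP f y).1 Wyu _ n0.
    have Wl : W (comb f l, u).
      by apply: subset_closure; apply/linear_span_comb; exists l.
    exists (l, u) => /=.
    rewrite -(subrK (h (y, u)) z) -addrA (le_trans (ler_normD _ _))//.
    rewrite mulr2n mulrDl mul1r lerD// addrC -scaleN1r -hZD// hq; last exact: WZD.
    rewrite (_ : _ + _ = (y - comb f l, 0)); last first.
      by apply/pair_equal_spec; rewrite /= !scaleN1r addNr addrC.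
    by rewrite (le_trans (q_le _ _))// normr0 addr0.
  have /choice[code codeP] : forall z, exists c : nat -> seq (R * X) * X,
      forall n, `|z - h (comb f (c n).1, (c n).2)| <= 2 * n.+1%:R^-1.
    by move=> z; have /choice[c cP] := approx z; exists c.
  exists code => u v uv; apply/eqP; rewrite -subr_eq0 -normr_le0 leNgt.
  apply/negP => uv0.
  have [n hn] : exists n, 4 / `|u - v| < n.+1%:R by eexists; exact: truncnS_gt.
  have := codeP u n; have := codeP v n; rewrite -uv; set w := h _ => hv hu.
  have : `|u - v| <= 4 / n.+1%:R.
    have := ler_normB (u - w) (v - w); rewrite opprB addrA subrK.
    move: hu hv; set c := n.+1%:R^-1; lra.
  by rewrite ler_pdivlMr// mulrC -ler_pdivlMr// leNgt hn.
Qed.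

End Gluing.

(** * Cardinality injectivity and stability *)

Lemma le_of_natmul_le (R : archiRealFieldType) (x c : R) :
  (forall n, n%:R * x <= c) -> x <= 0.
Proof.
move=> h; rewrite leNgt; apply/negP => x0.
have := h (Num.truncn (c / x)).+1.
by rewrite -ler_pdivlMr// leNgt truncnS_gt.
Qed.

Lemma operator_norm_le (R : realType) (V W : normedModType R)
    (P : {linear V -> W}) (lambda : R) :
  (operator_norm P <= lambda%:E)%E -> forall v, `|P v| <= lambda * `|v|.
Proof.
move=> Pl v; have [->|v0] := eqVneq v 0.
  by rewrite linear0 !normr0 mulr0.
have nv0 : 0 < `|v| by rewrite normr_gt0.
have n1 : `| `|v|^-1 *: v| = 1 by rewrite normrZ gtr0_norm ?invr_gt0// mulVf ?gt_eqF.
have : (`|P (`|v|^-1 *: v)|%:E <= lambda%:E)%E.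
  apply: le_trans Pl; apply: ereal_sup_ubound; exists (`|v|^-1 *: v) => //=.
  by rewrite n1.
rewrite lee_fin linearZZ normrZ gtr0_norm ?invr_gt0//.
by rewrite mulrC ler_pdivrMr.
Qed.

(** A bijection translated so as to fix the origin, then cut off outside the
    ball. *)
Lemma surjection_onto_ball {R : realType} {X Y : normedModType R} :
  ([set: Y] #= [set: X])%card ->
  exists g : X -> Y, [/\ g 0 = 0, forall x, `|g x| <= 1 &
    forall y, `|y| <= 1 -> exists x, g x = y].
Proof.
rewrite card_eq_sym => /card_set_bijP[h [_ _ hsurj]].
pose g x := if `|h x - h 0| <= 1 then h x - h 0 else 0.
exists g; split=> [|x|y y1].
- by rewrite /g subrr normr0 ler01.
- by rewrite /g; case: ifP => //; rewrite normr0.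
- have [x _ hx] := hsurj (y + h 0) I.
  by exists x; rewrite /g hx addrK y1.
Qed.

Section Perturbation.
Context {R : realType} {X Y : completeNormedModType R} (j : {linear X -> Y}).
Hypothesis jiso : forall x, `|j x| = `|x|.
Variable g : X -> Y.
Hypothesis g0 : g 0 = 0.
Hypothesis g1 : forall x, `|g x| <= 1.
Hypothesis gsurj : forall y, `|y| <= 1 -> exists x, g x = y.

Let f x := j x + g x.

Lemma perturbation_isometry : standard_eps_isometry 2 f.
Proof.
split=> [|x y]; first by rewrite /f linear0 g0 addr0.
have jB : j (x - y) = j x - j y by exact: linearB.
rewrite -(jiso (x - y)) jB; apply: le_trans (ler_dist_dist _ _) _.
rewrite /f (opprD (j y) (g y)) addrACA [X in `|X|]addrC addKr.
by rewrite (le_trans (ler_normB _ _))// (natrD _ 1 1) lerD.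
Qed.

(** The bounded perturbation disappears in [f (n x) / n], so [j x] lies in the
    closed span, and then so does [g x = f x - j x], an arbitrary point of the
    unit ball. *)
Lemma perturbation_span y : closed_span (range f) y.
Proof.
have jspan x : closed_span (range f) (j x).
  apply/closed_spanP => e e0; pose n := Num.truncn (e^-1).
  have ne : e^-1 < n.+1%:R by exact: truncnS_gt.
  exists [:: (n.+1%:R^-1, n.+1%:R *: x)]; rewrite /comb big_seq1 /f/= (linearZZ j).
  rewrite scalerDr scalerA mulVf ?pnatr_eq0// scale1r opprD addNKr normrN normrZ.
  rewrite ger0_norm ?invr_ge0// mulrC ler_pdivrMr//.
  by rewrite (le_trans (g1 _))// mulrC -ler_pdivrMr// mul1r ltW.
have ball_span z : `|z| <= 1 -> closed_span (range f) z.
  move=> /gsurj[x <-]; rewrite (_ : g x = (-1) *: j x + f x).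
    by apply: closed_spanZD => //; exact: closed_span_image.
  by rewrite scaleN1r /f addrA addNr add0r.
have [->|y0] := eqVneq y 0; first exact: closed_span0.
rewrite (_ : y = `|y| *: (`|y|^-1 *: y) + 0).
  apply: closed_spanZD; last exact: closed_span0.
  by apply: ball_span; rewrite normrZ normfV normr_id mulVf// normr_eq0.
by rewrite addr0 scalerA divff ?scale1r// normr_eq0.
Qed.

(** As [T] is linear and bounded on the values of [g], the hypothesis at [n x]
    bounds [n * `|T (j x) - x|] independently of [n], so [T] inverts [j]; then
    [T (g x) = T (f x) - x] bounds [T] on the unit ball. *)
Lemma perturbation_projection (gamma : R) (T : Y -> X) :
  bounded_linear_on (closed_span (range f)) T ->
  (forall x, `|T (f x) - x| <= gamma) ->
  exists P : {linear Y -> Y}, [/\ forall y, P (P y) = P y,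
    range P = range j & (operator_norm P <= gamma%:E)%E].
Proof.
move=> [Tlin [M TM]] Tf.
have {}Tlin : linear T by move=> a u v; apply: Tlin; exact: perturbation_span.
have [t tE] : exists t : {linear Y -> X}, t =1 T.
  pose Tmix := GRing.isLinear.Build R Y X *:%R T Tlin.
  pose t : {linear Y -> X} := HB.pack T Tmix.
  by exists t.
have tj x : t (j x) = x.
  apply/eqP; rewrite -subr_eq0 -normr_le0; apply: (@le_of_natmul_le _ _ (gamma + `|M|)).
  move=> n.
  have gM : `|t (g (n%:R *: x))| <= `|M|.
    rewrite tE (le_trans (TM _ (perturbation_span _)))//.
    apply: (@le_trans _ _ (`|M| * 1)); last by rewrite mulr1.
    by rewrite (le_trans (ler_wpM2r _ (ler_norm M)))// ler_wpM2l.
  have := Tf (n%:R *: x).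
  rewrite -tE /f linearD (linearZZ j) (linearZZ t) addrAC -scalerBr => h.
  rewrite -[n%:R]ger0_norm// -normrZ.
  rewrite -(addrK (t (g (n%:R *: x))) (n%:R *: _)) (le_trans (ler_normB _ _))//.
  exact: lerD.
have tball y : `|y| <= 1 -> `|t y| <= gamma.
  move=> /gsurj[x <-]; have := Tf x.
  by rewrite -tE /f linearD tj addrAC subrr add0r.
have [P PE] : exists P : {linear Y -> Y}, forall y, P y = j (t y).
  by exists (j \o t).
exists P; split.
- by move=> y; rewrite !PE tj.
- apply/seteqP; split=> _ [y _ <-]; first by rewrite PE; exists (t y).
  by exists (j y) => //; rewrite PE tj.
- by apply: ge_ereal_sup => _ [y /= y1 <-]; rewrite lee_fin PE jiso tball.
Qed.

End Perturbation.

Section Main.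
Context {R : realType} {X : completeNormedModType R}.

(** The operator is [j^-1 P S], with [S] and [j] from the gluing and [P] the
    projection onto the image of [j]; as [P] fixes [j x], it moves [S (f x)] to
    within [lambda * 3 * eps] of [j x].  The summand 1 in the constant keeps it
    positive when [lambda = 0]. *)
Lemma stable_of_injective : cardinality_injective X ->
  exists2 gamma : R, 0 < gamma &
     forall (Y : completeNormedModType R) (eps : R) (f : X -> Y),
       0 <= eps -> standard_eps_isometry eps f ->
       exists T : Y -> X,
         bounded_linear_on (closed_span (range f)) T /\
         forall x : X, `|T (f x) - x| <= gamma * eps.
Proof.
move=> [lambda lambda0 Xinj]; exists (3 * lambda + 1) => [|Y eps f eps0 fiso].
  by rewrite ltr_wpDl// mulr_ge0.
(* a code for scalars in X needs a nonzero vector *)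
have [[x0 x00]|X0] := pselect (exists x0 : X, x0 != 0); last first.
  have {}X0 (x : X) : x = 0.
    by apply/eqP; apply: contrapT => /negP x0; apply: X0; exists x.
  exists (fun=> 0); split=> [|x]; last first.
    by rewrite (X0 x) subrr normr0 mulr_ge0// addr_ge0// mulr_ge0.
  split=> [a u v _ _|]; first by rewrite scaler0 addr0.
  by exists 0 => u _; rewrite normr0 mul0r.
have [E [j [S [jiso SL Sle Sf EX]]]] := gluing f eps eps0 fiso x0 x00.
have [P [PP Pj /operator_norm_le Pn]] := Xinj E j jiso EX.
have /choice[T TE] : forall y, exists x, j x = P (S y).
  move=> y; have : range P (P (S y)) by exists (S y).
  by rewrite Pj => -[x _ <-]; exists x.
have jinj : injective j.
  move=> u v uv; apply/eqP; rewrite -subr_eq0 -normr_eq0 -jiso linearB uv.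
  by rewrite subrr normr0.
have Pfix x : P (j x) = j x.
  have : range P (j x) by rewrite Pj; exists x.
  by move=> [z _ <-]; rewrite PP.
exists T; split.
  split=> [a u v Lu Lv|].
    by apply: jinj; rewrite linearP !TE SL// linearP.
  exists lambda => u Lu; rewrite -jiso TE (le_trans (Pn _))//.
  by rewrite ler_wpM2l// Sle.
move=> x; rewrite -jiso linearB TE -(Pfix x) -(linearB P) (le_trans (Pn _))//.
apply: (@le_trans _ _ (lambda * (3 * eps))); first by rewrite ler_wpM2l// Sf.
lra.
Qed.

End Main.

Theorem theorem3p3 (R : realType) (X : completeNormedModType R) :
  (exists2 gamma : R, 0 < gamma &
     forall (Y : completeNormedModType R) (eps : R) (f : X -> Y),
       0 <= eps ->
       standard_eps_isometry eps f ->
       exists T : Y -> X,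
         bounded_linear_on (closed_span (range f)) T /\
         forall x : X, `|T (f x) - x| <= gamma * eps)
  <-> cardinality_injective X.
Proof.
split; last exact: stable_of_injective.
move=> [gamma gamma0 stable]; exists (gamma * 2); first by rewrite mulr_ge0// ltW.
move=> Y j jiso /surjection_onto_ball[g [g0 g1 gsurj]].
have [|T [Tlin Tf]] := stable Y 2 _ _ (perturbation_isometry j jiso g g0 g1); first by [].
exact: (perturbation_projection j jiso g g1 gsurj _ T Tlin Tf).
Qed.
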